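(* Let $P_0,P_1$ be probability measures on $(\mathcal X,\mathcal B_{\mathcal X})$ with $P_1\ll P_0$, $\mathrm{KL}(P_1\|P_0)<\infty$, $R=\frac{dP_1}{dP_0}$, and assume $\mathrm{Var}_{P_1}(\log R)<\infty$. Let $\alpha\in(0,1)$, $\ell=\log\frac1\alpha$. For $\beta>0$ with $Z_\beta:=\mathbb E_{P_0}[R^\beta]<\infty$ put $R_\beta:=R^\beta/Z_\beta$, $c_\beta:=\mathbb E_{P_1}[\log R_\beta]$ and $v_\beta:=\mathrm{Var}_{P_1}(\log R_\beta)=\beta^2\,\mathrm{Var}_{P_1}(\log R)$. Whenever $c_\beta\ell>2v_\beta$, the design $R_\beta$ has power $1-\bar\gamma_t(\alpha)$ at most $2v_\beta/(c_\beta\ell)=O(\beta)$ at every horizon $t\le\ell/(2c_\beta)$, and $$\frac{\ell}{2c_\beta}\ \sim\ \frac{\ell}{2\beta\big(\mathrm{KL}(P_0\|P_1)+\mathrm{KL}(P_1\|P_0)\big)}$$ diverges like $\beta^{-1}$ as $\beta\downarrow0$.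
   Context: For the design $R_\beta$ in the i.i.d. model ($\Omega=\mathcal X^{\mathbb N}$, coordinates $X_n$, $\mathbb P_1=P_1^{\otimes\mathbb N}$) the wealth is $W_0=1$, $W_t=\prod_{n\le t}R_\beta(X_n)$; $\tau_\alpha:=\inf\{t\in\mathbb N:W_t>\frac1\alpha\}$ ($\inf\emptyset=\infty$), $\bar\gamma_t(\alpha):=\mathbb P_1(\tau_\alpha>t)$ is the sequential type-II error. One has $c_\beta=\beta(\mathrm{KL}(P_1\|P_0)+\lambda(\beta))$ with $\lambda(\beta)=-\frac1\beta\log Z_\beta$. The $O(\beta)$ and the asymptotic equivalence $\sim$ are as $\beta\downarrow0$.
   Formalization: The final display (asymptotic equivalence and divergence like 1/β) is proved assuming KL(P0‖P1)<∞ and P0≠P1; without these it fails (P0 uniform on {0,1}, P1=δ_1 gives c_β=log 2 for all β) or is undefined (P0=P1). *)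

(* Defs.v *)
From HB Require Import structures.
From mathcomp Require Import all_boot all_order all_algebra.
From mathcomp Require Import all_classical all_reals all_analysis.
Import Order.TTheory GRing.Theory Num.Theory.
Import numFieldNormedType.Exports.

Set Implicit Arguments.
Unset Strict Implicit.
Unset Printing Implicit Defensive.

Local Open Scope classical_set_scope.
Local Open Scope ring_scope.

Section path_space.
Context {d : measure_display}.

Definition cylinders (X : measurableType d) : set (set (nat -> X)) :=
  \bigcup_(n in [set: nat])
    preimage_set_system [set: nat -> X] (fun w => w n) measurable.

Arguments cylinders : clear implicits.

(* The coordinate X_n (n = 1, 2, ...) of the process is [fun w => w n.-1]. *)
Definition path_space (X : measurableType d) := g_sigma_algebraType (cylinders X).

(* [PP] is the product measure P^{(x) nat}: the cylinder events with measurable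
   sides form a pi-system generating the sigma-algebra of [path_space X], so
   [PP] is the only probability measure with this property. *)
Definition is_infinite_product (R : realType) (X : measurableType d)
    (P : probability X R) (PP : probability (path_space X) R) :=
  forall (n : nat) (A : nat -> set X), (forall i, measurable (A i)) ->
    PP [set w : path_space X | forall i, (i < n)%N -> A i (w i)] =
    (\prod_(i < n) P (A i))%E.

End path_space.

Section divergence.
Context {d : measure_display} {X : measurableType d} {R : realType}.
Local Open Scope charge_scope.

Definition density (P Q : probability X R) : X -> \bar R :=
  'd (charge_of_finite_measure P) '/d Q.

(* The densities are only determined almost everywhere; a version takes finite
   nonnegative values everywhere. *)
Definition is_density_version (P Q : probability X R) (r : X -> R) :=
  [/\ measurable_fun [set: X] r, (forall x, 0 <= r x) &
      ae_eq Q [set: X] (EFin \o r) (density P Q)].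

(* [lne] sends 0 to -oo, but [density P Q] is positive P-almost everywhere. *)
Definition KL (P Q : probability X R) : \bar R :=
  if `[< P `<< Q >] then (\int[P]_x lne (density P Q x))%E else +oo%E.

End divergence.

Section power_design.
Context {d : measure_display} {X : measurableType d} {R : realType}.

Definition Z_ (P0 : probability X R) (r : X -> R) (b : R) : \bar R :=
  ('E_P0[(fun x => r x `^ b)%R])%E.

Definition power_design (P0 : probability X R) (r : X -> R) (b : R) : X -> R :=
  fun x => r x `^ b / fine (Z_ P0 r b).

(* [ln 0 = 0], but [r] vanishes only on a P1-null set. *)
Definition growth_rate (P0 P1 : probability X R) (r : X -> R) (b : R) : R :=
  fine ('E_P1[(fun x => ln (power_design P0 r b x))%R])%E.

Definition log_variance (P0 P1 : probability X R) (r : X -> R) (b : R) : R :=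
  fine ('V_P1[(fun x => ln (power_design P0 r b x))%R])%E.

End power_design.

Section sequential_test.
Context {d : measure_display} {X : measurableType d} {R : realType}.

Definition wealth (e : X -> R) (t : nat) (w : path_space X) : R :=
  \prod_(n < t) e (w n).

(* [ereal_inf set0 = +oo] *)
Definition stopping_time (e : X -> R) (alpha : R) (w : path_space X) : \bar R :=
  ereal_inf [set (t%:R)%:E | t in [set t : nat | alpha^-1 < wealth e t w]].

Definition type2_error (PP : probability (path_space X) R) (e : X -> R)
    (alpha : R) (t : nat) : \bar R :=
  PP [set w : path_space X | (t%:R%:E < stopping_time e alpha w)%E].

End sequential_test.

(* Main.v *)
Require Import Defs.
From HB Require Import structures.
From mathcomp Require Import all_boot all_order all_algebra.
From mathcomp Require Import all_classical all_reals all_analysis.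
From mathcomp Require Import measurable_realfun ring lra.
Import Order.TTheory GRing.Theory Num.Theory.
Import numFieldNormedType.Exports.
Local Open Scope classical_set_scope.
Local Open Scope ring_scope.

(** The wealth is the exponential of a random walk with i.i.d. increments of mean
    [c_b] and variance [v_b]. Before time [ell / (2 c_b)] the drift accounts for
    at most half of the level [ell], so a rejection forces the centered walk above
    [ell / 2], and Kolmogorov's maximal inequality bounds the probability of that
    by [t v_b / (ell / 2)^2 <= 2 v_b / (c_b ell)].

    With [K = E_1(ln R)], [c_b = b K - ln Z_b]. The inequality
    [r^b <= 1 + b (r - 1)] for [0 < b <= 1] gives [Z_b <= 1], hence [c_b >= b K];
    since [v_b] is quadratic in [b], this is the O(b) bound when [K > 0], and
    [K = 0] forces [R = 1] almost surely and [v_b = 0]. For the horizon,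
    [ln Z_b / b] is squeezed between [(Z_b - 1) / (b Z_b)] and [(Z_b - 1) / b],
    which both tend to [E_0(ln R) = - KL(P0 || P1)] by dominated convergence;
    hence [c_b / b] tends to the sum of the two divergences. *)

(** * Integrals of affine combinations of two functions *)

Lemma integrable_affine2 {R : realType} {d} {X : measurableType d}
    (P : probability X R) (f g : X -> R) (p q k : R) :
  P.-integrable [set: X] (EFin \o f) -> P.-integrable [set: X] (EFin \o g) ->
  P.-integrable [set: X] (EFin \o (fun x => p * f x + q * g x + k)).
Proof.
move=> fi gi.
rewrite (_ : _ \o _ = fun x => (p%:E * (f x)%:E + q%:E * (g x)%:E + k%:E)%E)//.
apply: integrableD => //; last exact: finite_measure_integrable_cst.
by apply: integrableD => //; exact: integrableZl.
Qed.

Lemma integral_affine2 {R : realType} {d} {X : measurableType d}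
    (P : probability X R) (f g : X -> R) (p q k : R) :
  P.-integrable [set: X] (EFin \o f) -> P.-integrable [set: X] (EFin \o g) ->
  (\int[P]_x (p * f x + q * g x + k)%:E =
   p%:E * (\int[P]_x (f x)%:E) + q%:E * (\int[P]_x (g x)%:E) + k%:E)%E.
Proof.
move=> fi gi.
under eq_integral do rewrite !EFinD !EFinM.
rewrite integralD//=; last 2 first.
- by apply: integrableD => //; exact: integrableZl.
- exact: finite_measure_integrable_cst.
rewrite integralD//=; [|exact: integrableZl..].
rewrite !integralZl// integral_cst//.
by congr (_ + _)%E; rewrite -[RHS]mule1; congr (_ * _)%E; exact: probability_setT.
Qed.

(** * Shift on the path space and the maximal inequality *)

Lemma measurable_coordinate {d} {X : measurableType d} (n : nat) :
  measurable_fun [set: path_space X] (fun w : path_space X => w n).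
Proof.
move=> _ B mB; rewrite setTI; apply: sub_sigma_algebra.
by exists n => //; exists B => //; rewrite setTI.
Qed.

Lemma measurable_to_path_space {d d'} {X : measurableType d}
    {Y : measurableType d'} (f : Y -> path_space X) :
  (forall n, measurable_fun [set: Y] (fun y => f y n)) ->
  measurable_fun [set: Y] f.
Proof.
move=> mf; have := @measurability _ _ Y (path_space X) setT f (@cylinders _ X) erefl.
apply.
move=> _ [_ [n _ [B mB <-]] <-].
by rewrite !setTI -[_ @^-1` _]setTI; exact: mf.
Qed.

(** Taking a pair as argument makes this a map on the product space, so that the product of [P] and
    [PP] can be pushed forward along it. *)
Definition path_cons {d} {X : measurableType d} (p : X * path_space X) :
  path_space X := fun n => if n is m.+1 then p.2 m else p.1.

Lemma measurable_path_cons {d} {X : measurableType d} :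
  measurable_fun [set: X * path_space X] (@path_cons d X).
Proof.
apply: measurable_to_path_space => -[|n] /=; first exact: measurable_fst.
exact: (measurableT_comp (measurable_coordinate n) measurable_snd).
Qed.

(** The pi-system on which [is_infinite_product] prescribes the measure. *)
Definition rectangles {d} (X : measurableType d) : set (set (path_space X)) :=
  [set E | exists (n : nat) (A : nat -> set X), (forall i, measurable (A i)) /\
     E = [set w | forall i, (i < n)%N -> A i (w i)]].

Lemma rectangles_setI_closed {d} (X : measurableType d) :
  setI_closed (rectangles X).
Proof.
(* Padding with [setT] brings two rectangles to a common length, after which they intersect side by
   side. *)
have widen n m A : (n <= m)%N -> exists A' : nat -> set X,
    ((forall i, measurable (A i)) -> forall i, measurable (A' i)) /\
    [set w : path_space X | forall i, (i < n)%N -> A i (w i)] =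
    [set w : path_space X | forall i, (i < m)%N -> A' i (w i)].
  move=> nm; exists (fun i => if (i < n)%N then A i else setT); split.
    by move=> mA i; case: ifP.
  apply/seteqP; split => w /= Aw i im; first by case: ifPn => // /Aw.
  by have := Aw i (leq_trans im nm); rewrite im.
move=> _ _ [n [A [mA ->]]] [m [B [mB ->]]].
have [A' [mA' ->]] := widen _ _ A (leq_maxl n m).
have [B' [mB' ->]] := widen _ _ B (leq_maxr n m).
exists (maxn n m), (fun i => A' i `&` B' i); split.
  by move=> i; apply: measurableI; [exact: mA'|exact: mB'].
apply/seteqP; split => w /=; first by move=> [Aw Bw] i im; split; auto.
by move=> ABw; split => i /ABw[].
Qed.

Lemma measurable_rectangles {d} (X : measurableType d) :
  @measurable _ (path_space X) = <<s rectangles X >>.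
Proof.
apply/seteqP; split.
  apply: smallest_sub; first exact: smallest_sigma_algebra.
  move=> _ [n _ [B mB <-]]; apply: sub_sigma_algebra.
  exists n.+1, (fun i => if i == n then B else setT); split.
    by move=> i; case: ifP.
  apply/seteqP; split => w /=; last by move=> /(_ n); rewrite eqxx; auto.
  by move=> [_ Bw] i _; case: eqP => // ->.
apply: smallest_sub; first exact: sigma_algebra_measurable.
move=> _ [n [A [mA ->]]].
have -> : [set w : path_space X | forall i, (i < n)%N -> A i (w i)] =
    \bigcap_(i in `I_n) [set w : path_space X | A i (w i)] by [].
apply: bigcap_measurableType => i _.
by rewrite -[X in measurable X]setTI; exact: measurable_coordinate.
Qed.

(** Prepending an independent draw from [P] does not change the law of the path. Two finite measures
    agreeing on a generating pi-system are equal, and on a rectangle the first side splits off as a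
    factor, leaving the rectangle of the shifted sides. *)
Lemma infinite_product_cons {R : realType} {d} {X : measurableType d}
    {P : probability X R} {PP : probability (path_space X) R} :
  is_infinite_product P PP -> forall E : set (path_space X), measurable E ->
  PP E = (\int[P]_x PP [set w | E (path_cons (x, w))])%E.
Proof.
move=> PPE.
(* The right side is a measure in [E]: the image of the product measure under [path_cons], which
   integrates the [PP]-measures of sections. *)
pose pushf : {measure set _ -> \bar R} :=
  pushforward (P \x PP)%E (@path_cons d X).
pose m2 := pushf measurable_path_cons.
have m2E E : m2 E = (\int[P]_x PP [set w | E (path_cons (x, w))])%E.
  rewrite /m2/= /pushforward/= /product_measure1.
  by apply: eq_integral => x _; rewrite /= xsectionE.
move=> E mE; rewrite -m2E.
apply: (measure_unique (rectangles X) (fun _ => setT)) => //.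
- exact: measurable_rectangles.
- exact: rectangles_setI_closed.
- move=> _; exists 0, (fun _ => setT); split => //.
  by apply/seteqP; split.
- by apply/seteqP; split => // w _; exists 0.
- move=> _ [n [A [mA ->]]]; rewrite m2E; etransitivity; first exact: PPE.
  case: n => [|n].
    rewrite big_ord0 (eq_integral (cst 1%E)).
      by rewrite integral_cst// mul1e; exact/esym/probability_setT.
    move=> x _; etransitivity; last exact: probability_setT PP.
    by congr (PP _); apply/seteqP; split.
  rewrite big_ord_recl.
  have <- := PPE n (fun i => A i.+1) (fun i => mA i.+1).
  (* The first factor becomes the integral of an indicator, so that both sides are integrals over
     the first coordinate. *)
  rewrite muleC -[in LHS](setIT (A ord0)) -integral_indic//.
  rewrite -ge0_integralZl//; last by apply/measurable_EFinP; exact: measurable_indic.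
  apply: eq_integral => x _; rewrite indicE.
  case: (boolP (x \in A 0)) => [/set_mem Ax|/negP Ax].
    rewrite mule1; congr (PP _); apply/seteqP; split => w /= Aw.
      by move=> [|i]//; exact: Aw.
    by move=> i; exact: (Aw i.+1).
  rewrite mule0 (_ : mkset _ = set0) ?measure0//.
  by apply/seteqP; split => // w /= /(_ 0 erefl) /mem_set.
- by move=> _; rewrite (le_lt_trans (probability_le1 _ _))// ltry.
Qed.

Lemma measurable_random_walk_exceeds {R : realType} {d} {X : measurableType d}
    (xi : X -> R) (a s : R) (n : nat) : measurable_fun [set: X] xi ->
  measurable [set w : path_space X |
    exists2 k : nat, (k <= n)%N & a < s + \sum_(i < k) xi (w i)].
Proof.
move=> mxi; have -> : [set w : path_space X |
      exists2 k : nat, (k <= n)%N & a < s + \sum_(i < k) xi (w i)] =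
    \bigcup_(k in `I_n.+1)
      [set w : path_space X | a < s + \sum_(i < k) xi (w i)] by [].
apply: bigcup_measurable => k _.
have mS : measurable_fun [set: path_space X]
    (fun w : path_space X => s + \sum_(i < k) xi (w i)).
  apply: measurable_funD => //; apply: measurable_sum => i.
  exact: (measurableT_comp mxi (measurable_coordinate i)).
rewrite -[X in measurable X]setTI.
have := mS measurableT `]a, +oo[%classic (measurable_itv _).
by congr (measurable (_ `&` _)); apply/seteqP; split => w /=;
  rewrite in_itv/= andbT.
Qed.

(* Induction on the number of steps: [(s + S_k)^2 + (n - k) v] is a
   supermartingale, so it is enough to condition on the first coordinate. *)
Lemma random_walk_maximal_inequality {R : realType} {d} {X : measurableType d}
    {P : probability X R} {PP : probability (path_space X) R} {xi : X -> R}
    {v a : R} :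
  is_infinite_product P PP -> measurable_fun [set: X] xi ->
  P.-integrable [set: X] (EFin \o xi) ->
  P.-integrable [set: X] (EFin \o (fun x => xi x ^+ 2)) ->
  (\int[P]_x (xi x)%:E = 0)%E -> (\int[P]_x (xi x ^+ 2)%:E = v%:E)%E ->
  0 < a -> forall (n : nat) (s : R),
  (PP [set w : path_space X | exists2 k : nat, (k <= n)%N &
                 (a < s + \sum_(i < k) xi (w i))%R]
     <= ((s ^+ 2 + n%:R * v) / a ^+ 2)%:E)%E.
Proof.
move=> PPE mxi ixi ixi2 xi0 xi2 a0.
pose E n s := [set w : path_space X |
  exists2 k : nat, (k <= n)%N & a < s + \sum_(i < k) xi (w i)].
have mE n s : measurable (E n s) by exact: measurable_random_walk_exceeds.
have v0 : 0 <= v.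
  by rewrite -lee_fin -xi2; apply: integral_ge0 => x _; rewrite lee_fin sqr_ge0.
(* For a start above [a] the claimed bound is at least 1, so only [s <= a] needs an argument. *)
have bound n s : a < s -> (PP (E n s) <= ((s ^+ 2 + n%:R * v) / a ^+ 2)%:E)%E.
  move=> as_; apply: le_trans (probability_le1 _ (mE n s)) _.
  rewrite lee_fin ler_pdivlMr ?exprn_gt0// mul1r.
  rewrite (le_trans (_ : _ <= s ^+ 2))//; last by rewrite lerDl mulr_ge0.
  by rewrite ler_sqr ?nnegrE ?ltW// (lt_trans a0).
elim=> [|n IH] s; rewrite -/(E _ _).
  have [/bound//|sa] := ltP a s.
  rewrite (_ : E _ _ = set0) ?measure0.
    by rewrite lee_fin mul0r addr0 divr_ge0 ?sqr_ge0.
  apply/seteqP; split => // w [k]; rewrite leqn0 => /eqP ->.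
  by rewrite big_ord0 addr0 ltNge sa.
have [/bound//|sa] := ltP a s.
rewrite (infinite_product_cons PPE)//.
(* As [s <= a], no crossing occurs at [k = 0]; the first coordinate is absorbed into the starting
   point and one step fewer remains. *)
have consE x : [set w | E n.+1 s (path_cons (x, w))] = E n (s + xi x).
  apply/seteqP; split => w /=.
    move=> [[|k] kn]; first by rewrite big_ord0 addr0 ltNge sa.
    by rewrite big_ord_recl/= addrA => h; exists k.
  by move=> [k kn h]; exists k.+1; rewrite // big_ord_recl addrA.
under eq_integral do rewrite consE.
have affine x : ((s + xi x) ^+ 2 + n%:R * v) / a ^+ 2 =
    (2 * s / a ^+ 2) * xi x + a ^- 2 * xi x ^+ 2 + (s ^+ 2 + n%:R * v) / a ^+ 2.
  by rewrite sqrrD; ring.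
apply: (@le_trans _ _ (\int[P]_x (((s + xi x) ^+ 2 + n%:R * v) / a ^+ 2)%:E)%E).
  apply: ge0_le_integral => //.
  - have mcE : measurable (@path_cons d X @^-1` E n.+1 s).
      by rewrite -[X in measurable X]setTI; exact: measurable_path_cons.
    rewrite (_ : (fun x => _) = PP \o xsection (@path_cons d X @^-1` E n.+1 s)).
      exact (measurable_fun_xsection PP mcE).
    by rewrite funeqE => x /=; rewrite xsectionE -consE.
  - under eq_fun do rewrite affine.
    exact: measurable_int (integrable_affine2 _ _ _ _ _ _ ixi ixi2).
  - by move=> x _; exact: IH.
under eq_integral do rewrite affine.
(* The linear term has mean zero and the quadratic one contributes [v / a ^+ 2], which raises [n] to
   [n.+1]. *)
rewrite integral_affine2// xi0 xi2 mule0 add0e -EFinM -EFinD lee_fin.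
by rewrite -natr1 le_eqVlt; apply/orP; left; apply/eqP; ring.
Qed.

(** * Power at short horizons *)

Lemma not_lt_stopping_time {R : realType} {d} {X : measurableType d}
    (e : X -> R) (alpha : R) (t : nat) (w : path_space X) :
  ~ (t%:R%:E < stopping_time e alpha w)%E <->
  exists2 n, (n <= t)%N & alpha^-1 < wealth e n w.
Proof.
split=> [|[n nt Wn]]; last first.
  apply/negP; rewrite -leNgt; apply: (@le_trans _ _ n%:R%:E).
    by apply: ereal_inf_lbound; exists n.
  by rewrite lee_fin ler_nat.
(* Crossing times are integers: if none is at most [t], the infimum is at least [t.+1], also when
   there is no crossing at all. *)
apply: contra_notP => noW; apply: (@lt_le_trans _ _ t.+1%:R%:E).
  by rewrite lte_fin ltr_nat.
apply: le_ereal_inf_tmp => _ [n Wn <-]; rewrite lee_fin ler_nat ltnNge.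
by apply/negP => nt; apply: noW; exists n.
Qed.

Lemma measurable_wealth {R : realType} {d} {X : measurableType d}
    (e : X -> R) (n : nat) :
  measurable_fun [set: X] e -> measurable_fun [set: path_space X] (wealth e n).
Proof.
move=> me; apply: measurable_prod => i _.
exact: (measurableT_comp me (measurable_coordinate i)).
Qed.

Lemma measurable_lt_stopping_time {R : realType} {d} {X : measurableType d}
    (e : X -> R) (alpha : R) (t : nat) : measurable_fun [set: X] e ->
  measurable [set w : path_space X | (t%:R%:E < stopping_time e alpha w)%E].
Proof.
move=> me; rewrite -[X in measurable X]setCK; apply: measurableC.
have -> : ~` [set w : path_space X | (t%:R%:E < stopping_time e alpha w)%E] =
    \bigcup_(n in `I_t.+1) (wealth e n @^-1` `]alpha^-1, +oo[%classic).
  apply/seteqP; split => w /=.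
    by move=> /not_lt_stopping_time[n nt Wn]; exists n; rewrite //= in_itv/= Wn.
  move=> [n nt]; rewrite /= in_itv/= andbT => Wn.
  by apply/not_lt_stopping_time; exists n.
apply: bigcup_measurable => n _; rewrite -[X in measurable X]setTI.
exact: (measurable_wealth _ n me).
Qed.

(** A positive product of nonnegative factors has only positive factors, so the convention
    [ln 0 = 0] never interferes. *)
Lemma ln_wealth {R : realType} {d} {X : measurableType d} (e : X -> R)
    (n : nat) (w : path_space X) : (forall x, 0 <= e x) -> 0 < wealth e n w ->
  ln (wealth e n w) = \sum_(i < n) ln (e (w i)).
Proof.
move=> e0; rewrite /wealth; elim: n => [|n IH]; first by rewrite !big_ord0 ln1.
rewrite !big_ord_recr/= => W0.
have en : 0 < e (w n).
  by rewrite lt_neqAle e0 andbT; apply: contraTneq W0 => <-; rewrite mulr0 ltxx.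
have Wn : 0 < \prod_(i < n) e (w i) by rewrite -(pmulr_lgt0 _ en).
by rewrite lnM ?posrE// IH.
Qed.

Lemma power_le_of_short_horizon {R : realType} {d} {X : measurableType d}
    (P : probability X R) (PP : probability (path_space X) R) (e : X -> R)
    (alpha c v : R) (t : nat) :
  is_infinite_product P PP -> measurable_fun [set: X] e ->
  (forall x, 0 <= e x) -> 0 < alpha -> alpha < 1 ->
  P.-integrable [set: X] (EFin \o (fun x => ln (e x))) ->
  (\int[P]_x (ln (e x))%:E = c%:E)%E ->
  P.-integrable [set: X] (EFin \o (fun x => (ln (e x) - c) ^+ 2)) ->
  (\int[P]_x ((ln (e x) - c) ^+ 2)%:E = v%:E)%E ->
  0 < c -> t%:R <= ln alpha^-1 / (2 * c) ->
  (1 - type2_error PP e alpha t <= (2 * v / (c * ln alpha^-1))%:E)%E.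
Proof.
move=> PPE me e0 a0 a1 iL Lc iL2 Lv c0; set l := ln alpha^-1 => tl.
have l0 : 0 < l by rewrite ln_gt0// invf_gt1.
have v0 : 0 <= v.
  by rewrite -lee_fin -Lv; apply: integral_ge0 => x _; rewrite lee_fin sqr_ge0.
have affine x : ln (e x) - c = 1 * ln (e x) + 0 * ln (e x) - c by ring.
have iC : P.-integrable [set: X] (EFin \o (fun x => ln (e x) - c)).
  by under eq_fun do rewrite affine; exact: integrable_affine2.
have mC : (\int[P]_x (ln (e x) - c)%:E = 0)%E.
  under eq_integral do rewrite affine.
  by rewrite integral_affine2// Lc mul1e mul0e adde0 -EFinD subrr.
have mxi : measurable_fun [set: X] (fun x => ln (e x) - c).
  by apply/measurable_EFinP; exact: measurable_int iC.
have l20 : 0 < l / 2 by rewrite divr_gt0.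
have := random_walk_maximal_inequality PPE mxi iC iL2 mC Lv l20 t 0.
rewrite expr0n/= add0r => maxineq.
have mA := measurable_lt_stopping_time _ alpha t me.
rewrite /type2_error -probability_setC//.
(* At the largest admissible horizon [l / (2 * c)] the maximal bound equals the claimed one. *)
apply: (@le_trans _ _ (t%:R * v / (l / 2) ^+ 2)%:E); last first.
  rewrite lee_fin.
  have -> : 2 * v / (c * l) = (l / (2 * c)) * v / (l / 2) ^+ 2.
    by field; rewrite !gt_eqF.
  by rewrite ler_pM2r ?invr_gt0 ?exprn_gt0// ler_wpM2r.
apply: le_trans maxineq; apply: le_measure; rewrite ?inE.
- exact: measurableC.
- exact: measurable_random_walk_exceeds mxi.
move=> w /= /not_lt_stopping_time[n nt Wn]; exists n => //.
rewrite add0r sumrB sumr_const card_ord.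
have W0 : 0 < wealth e n w by rewrite (lt_trans _ Wn)// invr_gt0.
rewrite -(ln_wealth _ _ _ e0 W0).
have lW : l < ln (wealth e n w) by rewrite ltr_ln// posrE invr_gt0.
have nc : c *+ n <= l / 2.
  rewrite -[c *+ n]mulr_natl; apply: (@le_trans _ _ (l / (2 * c) * c)).
    by rewrite ler_wpM2r ?(ltW c0)// (le_trans _ tl)// ler_nat.
  by rewrite le_eqVlt; apply/orP; left; apply/eqP; field; rewrite gt_eqF.
by rewrite ltrBrDr (le_lt_trans _ lW)// [leRHS]splitr lerD2l.
Qed.

(** * Integration and elementary inequalities *)

Lemma ae_integrable {R : realType} {d} {X : measurableType d}
    (mu : {measure set X -> \bar R}) (f g : X -> \bar R) :
  measurable_fun [set: X] g -> ae_eq mu [set: X] f g ->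
  mu.-integrable [set: X] f -> mu.-integrable [set: X] g.
Proof.
move=> mg fg /integrableP[mf foo]; apply/integrableP; split => //.
rewrite -(@ge0_ae_eq_integral _ _ _ mu _ (abse \o f) (abse \o g))//.
- exact: measurableT_comp.
- exact: measurableT_comp.
- by move=> x _; exact: abse_ge0.
- by move=> x _; exact: abse_ge0.
- exact: ae_eq_abse.
Qed.

(** The density is finite everywhere, so [lne] of it is a case split on a measurable real
    function. *)
Lemma measurable_lne_density {R : realType} {d} {X : measurableType d}
    {P Q : probability X R} : P `<< Q ->
  measurable_fun [set: X] (fun x => lne (density P Q x)).
Proof.
move=> PQ; pose q x := fine (density P Q x).
have mq : measurable_fun [set: X] q.
  apply: measurableT_comp => //.
  have iq : Q.-integrable [set: X] (density P Q).
    exact: Radon_Nikodym_integrable.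
  exact: measurable_int iq.
have -> : (fun x => lne (density P Q x)) =
    (fun x => if q x <= 0 then -oo%E else (ln (q x))%:E).
  by apply/funext => x; rewrite -[density P Q x]fineK// Radon_Nikodym_fin_num.
apply: measurable_fun_ifT => //; first exact: measurable_fun_ler.
by apply/measurable_EFinP; exact: measurableT_comp.
Qed.

Lemma powR_le_affine {R : realType} (x b : R) : 0 <= x -> 0 < b <= 1 ->
  x `^ b <= 1 + b * (x - 1).
Proof.
rewrite le_eqVlt => /predU1P[<-|x0] /andP[b0 b1].
  by rewrite powR0 ?gt_eqF//; lra.
rewrite /powR gt_eqF//; set L := ln x.
(* Average, with weights [1 - b] and [b], of the tangent bounds [1 + u <= e^u]
   that compare [1] and [x] with [x `^ b]. *)
have xE : x = expR (b * L) * expR ((1 - b) * L).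
  by rewrite -expRD -mulrDl addrC subrK mul1r lnK.
have oneE : 1 = expR (b * L) * expR (- (b * L)) by rewrite -expRD subrr expR0.
have h1 := expR_ge1Dx ((1 - b) * L).
have h2 := expR_ge1Dx (- (b * L)).
have e0 := expR_gt0 (b * L).
have : expR (b * L) * ((1 - b) * (1 + - (b * L)) + b * (1 + (1 - b) * L)) <=
    expR (b * L) * ((1 - b) * expR (- (b * L)) + b * expR ((1 - b) * L)).
  rewrite ler_pM2l// lerD//; first by rewrite ler_wpM2l// subr_ge0.
  by rewrite ler_pM2l.
rewrite (_ : _ * (_ * (1 + - _) + _) = expR (b * L)); last by ring.
rewrite mulrDr [_ * ((1 - b) * _)]mulrCA [_ * (b * _)]mulrCA -oneE -xE.
by lra.
Qed.

(** The tangent bound [1 + u <= e^u] at [u = - ln x], multiplied by [x]. It provides a nonnegative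
    integrand for [E_1(ln r)] under [P0]. *)
Lemma xlnx_ge {R : realType} (x : R) : 0 <= x -> 0 <= x * ln x - x + 1.
Proof.
rewrite le_eqVlt => /predU1P[<-|x0]; first by rewrite mul0r subr0 add0r.
have : x * (1 + - ln x) <= x * expR (- ln x).
  by rewrite ler_pM2l// expR_ge1Dx.
rewrite expRN lnK// divff ?gt_eqF//; lra.
Qed.

(** The same tangent bound is strict unless [u = 0]. *)
Lemma xlnx_eq {R : realType} (x : R) : 0 <= x -> x * ln x - x + 1 = 0 -> x = 1.
Proof.
rewrite le_eqVlt => /predU1P[<-|x0 h]; first by rewrite mul0r subr0 add0r.
have [->//|x1] := eqVneq x 1.
have : x * (1 + - ln x) < x * expR (- ln x).
  by rewrite ltr_pM2l// expR_gt1Dx// oppr_eq0 ln_eq0.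
rewrite expRN lnK// divff ?gt_eqF//; lra.
Qed.

Lemma ge0_integrable {R : realType} {d} {X : measurableType d}
    (mu : {measure set X -> \bar R}) (f : X -> \bar R) :
  measurable_fun [set: X] f -> (forall x, 0 <= f x)%E ->
  (\int[mu]_x f x < +oo)%E -> mu.-integrable [set: X] f.
Proof.
move=> mf f0 foo; apply/integrableP; split => //.
by under eq_integral do rewrite gee0_abs//.
Qed.

Lemma varianceE_integral {R : realType} {d} {X : measurableType d}
    (P : probability X R) (f : X -> R) :
  ('V_P[f] = \int[P]_x ((f x - fine (\int[P]_y (f y)%:E)) ^+ 2)%:E)%E.
Proof. by rewrite /variance unlock [in LHS]unlock. Qed.

(** The variance is centered at the [fine] of an integral not yet known to be finite. The
    dominations below therefore hold for any real center [m]. *)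
Lemma finite_variance_integrable {R : realType} {d} {X : measurableType d}
    (P : probability X R) (f : X -> R) :
  measurable_fun [set: X] f -> ('V_P[f] < +oo)%E ->
  P.-integrable [set: X] (EFin \o f) /\
  P.-integrable [set: X] (EFin \o (fun x => f x ^+ 2)).
Proof.
rewrite varianceE_integral; set m := fine _ => mf Voo.
pose g x := (f x - m) ^+ 2.
have mg : measurable_fun [set: X] g by exact/measurable_funX/measurable_funB.
have gi : P.-integrable [set: X] (EFin \o g).
  apply: ge0_integrable => //; first exact/measurable_EFinP.
  by move=> x; rewrite lee_fin sqr_ge0.
have gai p k := integrable_affine2 P g g p 0 k gi gi.
split.
  apply: (le_integrable _ _ _ (gai 1 (1 + `|m|))) => //.
    exact/measurable_EFinP.
  move=> x _ /=; rewrite lee_fin mul1r mul0r addr0.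
  have n0 : 0 <= g x + (1 + `|m|) by rewrite !addr_ge0// sqr_ge0.
  rewrite [leRHS]ger0_norm// -[f x](subrK m).
  rewrite (le_trans (ler_normD _ _))// addrA lerD2r.
  rewrite /g -real_normK ?num_real//.
  (* This square gives [|y| <= y^2 + 1/4] for [y = f x - m]. *)
  by have := sqr_ge0 (`|f x - m| - 1/2); rewrite !expr2; lra.
apply: (le_integrable _ _ _ (gai 2 (2 * m ^+ 2))) => //.
  by apply/measurable_EFinP; exact: measurable_funX.
move=> x _ /=; rewrite lee_fin mul0r addr0.
have n0 : 0 <= 2 * g x + 2 * m ^+ 2 by rewrite addr_ge0// mulr_ge0// sqr_ge0.
rewrite !ger0_norm ?sqr_ge0//.
by have := sqr_ge0 (f x - 2 * m); rewrite /g !expr2; lra.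
Qed.

(** Meant for [f] the log of the design and [g = ln r]. The affine relation is only almost sure
    because [ln 0 = 0] can break it where [r] vanishes. *)
Lemma integral_ae_affine {R : realType} {d} {X : measurableType d}
    (P : probability X R) (f g : X -> R) (b k : R) :
  measurable_fun [set: X] f -> measurable_fun [set: X] g ->
  ('V_P[g] < +oo)%E -> (\forall x \ae P, f x = b * g x - k) ->
  let m := b * fine (\int[P]_x (g x)%:E)%E - k in
  [/\ P.-integrable [set: X] (EFin \o f), (\int[P]_x (f x)%:E = m%:E)%E,
      P.-integrable [set: X] (EFin \o (fun x => (f x - m) ^+ 2)) &
      (\int[P]_x ((f x - m) ^+ 2)%:E = (b ^+ 2)%:E * 'V_P[g])%E].
Proof.
move=> mf mg Voo fg.
have [gi g2i] := finite_variance_integrable P g mg Voo.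
set K := fine (\int[P]_x (g x)%:E)%E; move=> m.
have KE : (\int[P]_x (g x)%:E = K%:E)%E by rewrite fineK// integrable_fin_num.
have fgE : ae_eq P [set: X] (fun x => (b * g x + 0 * g x + - k)%:E) (EFin \o f).
  by apply: filterS fg => x /= -> _; rewrite mul0r addr0.
have ai := integrable_affine2 P g g b 0 (- k) gi gi.
have mf' : measurable_fun [set: X] (EFin \o f) by exact/measurable_EFinP.
have fE : (\int[P]_x (f x)%:E = m%:E)%E.
  rewrite -(ae_eq_integral _ _ _ _ _ fgE)//; last exact: measurable_int ai.
  by rewrite integral_affine2// KE mul0e adde0 -EFinM -EFinD.
pose h x := (g x - K) ^+ 2.
have mh : measurable_fun [set: X] h by exact/measurable_funX/measurable_funB.
have hE : (\int[P]_x (h x)%:E = 'V_P[g])%E by rewrite varianceE_integral.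
have hi : P.-integrable [set: X] (EFin \o h).
  apply: ge0_integrable; [exact/measurable_EFinP| |by rewrite hE].
  by move=> x; rewrite lee_fin sqr_ge0.
have fm2 : ae_eq P [set: X] (fun x => ((b ^+ 2)%:E * (h x)%:E)%E)
    (EFin \o (fun x => (f x - m) ^+ 2)).
  apply: filterS fg => x /= -> _; rewrite -EFinM; congr EFin.
  by rewrite /h /m; ring.
have mfm : measurable_fun [set: X] (EFin \o (fun x => (f x - m) ^+ 2)).
  by apply/measurable_EFinP; exact/measurable_funX/measurable_funB.
have bhi := integrableZl measurableT (b ^+ 2) hi.
split => //.
- exact: ae_integrable fgE ai.
- exact: ae_integrable fm2 bhi.
- rewrite -(ae_eq_integral _ _ _ _ _ fm2)//; last exact: measurable_int bhi.
  by rewrite integralZl// hE.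
Qed.

(** The negative part is at most [|g|], so its integral is finite, and the upper bound on the
    integral of [f] passes to the positive part. *)
Lemma integrable_bounded_below {R : realType} {d} {X : measurableType d}
    (mu : {measure set X -> \bar R}) (f g : X -> \bar R) :
  measurable_fun [set: X] f -> mu.-integrable [set: X] g ->
  (forall x, - f x <= g x)%E -> (\int[mu]_x f x < +oo)%E ->
  mu.-integrable [set: X] f.
Proof.
move=> mf gi fg foo.
have negi : mu.-integrable [set: X] f^\-%E.
  apply: le_integrable gi => //; first exact: measurable_funeneg.
  move=> x _; rewrite gee0_abs// funenegE ge_max abse_ge0 andbT.
  exact: le_trans (fg x) (lee_abs _).
have posi : mu.-integrable [set: X] f^\+%E.
  apply: ge0_integrable => //; first exact: measurable_funepos.
  have negfin := integrable_fin_num measurableT negi.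
  by move: foo; rewrite integralE lteBlDr// addye//; case/fin_numP: negfin.
by rewrite (funeposneg f); exact: integrableB.
Qed.

(** This is [1 + y <= e^y] at [y = b * ln x]; the companion upper bound is the same inequality at
    [- y], multiplied by [e^y]. *)
Lemma powR_quotient_ge {R : realType} (x b : R) : 0 < x -> 0 < b ->
  ln x <= (x `^ b - 1) / b.
Proof.
move=> x0 b0; rewrite ler_pdivlMr// /powR gt_eqF//.
by have := expR_ge1Dx (b * ln x); lra.
Qed.

Lemma powR_quotient_le {R : realType} (x b : R) : 0 < x -> 0 < b ->
  (x `^ b - 1) / b <= ln x * x `^ b.
Proof.
move=> x0 b0; rewrite ler_pdivrMr// /powR gt_eqF//; set y := b * ln x.
have : expR y * (1 - y) <= expR y * expR (- y).
  by rewrite ler_pM2l ?expR_gt0// expR_ge1Dx.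
by rewrite -expRD subrr expR0 {2}/y; lra.
Qed.

(** Stated along sequences because dominated convergence is applied to sequences. *)
Lemma powR_quotient_cvg {R : realType} (x : R) (u : R^nat) : 0 < x ->
  (forall n, 0 < u n) -> u n @[n --> \oo] --> 0 ->
  (x `^ u n - 1) / u n @[n --> \oo] --> ln x.
Proof.
move=> x0 u0 ucvg; apply: (@squeeze_cvgr _ _ _ _ (cst (ln x)) (fun n => ln x * x `^ u n)).
- by near=> n; rewrite powR_quotient_ge// powR_quotient_le.
- exact: cvg_cst.
- rewrite -[X in _ --> X]mulr1; apply: cvgM; first exact: cvg_cst.
  have -> : (fun n => x `^ u n) = (fun n => expR (u n * ln x)).
    by apply/funext => n; rewrite /powR gt_eqF.
  rewrite -expR0; apply: continuous_cvg; first exact: continuous_expR.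
  by rewrite -[X in _ --> X](mul0r (ln x)); apply: cvgM => //; exact: cvg_cst.
Unshelve. all: by end_near. Qed.

(** Write [c b = h * b] with [h --> D]. The two equivalent functions have ratio [D / h], and
    eventually [D / 2 < h < 2 * D], which encloses the horizon between multiples of [b^-1]. *)
Lemma inverse_rate_asymptotics {R : realType} (c : R -> R) (ell D : R) :
  0 < ell -> 0 < D -> c b / b @[b --> 0^'+] --> D ->
  [/\ (fun b : R => ell / (2 * c b)) ~_ (0^'+)
        (fun b : R => ell / (2 * b * D)),
      ell / (2 * c b) @[b --> 0^'+] --> +oo &
      (fun b : R => ell / (2 * c b)) =Theta_ (0^'+) (fun b : R => b^-1)].
Proof.
move=> ell0 D0 cD.
have hlt : \forall b \near 0^'+, c b / b < 2 * D.
  by move/cvgr_lt : cD; apply; lra.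
have hgt : \forall b \near 0^'+, D / 2 < c b / b.
  by move/cvgr_gt : cD; apply; lra.
have cE b : 0 < b -> c b = c b / b * b by move=> b0; rewrite divfK ?gt_eqF.
have bounds : \forall b \near 0^'+, ell / (4 * D) * b^-1 <= ell / (2 * c b) /\
    ell / (2 * c b) <= ell / D * b^-1.
  near=> b.
  have b0 : 0 < b by near: b; exact: nbhs_right_gt.
  have h1 : c b / b < 2 * D by near: b.
  have h2 : D / 2 < c b / b by near: b.
  have h0 : 0 < c b / b by rewrite (lt_trans _ h2)// divr_gt0.
  rewrite cE//; set h := c b / b in h0 h1 h2 *.
  have l1 : 2 * (h * b) <= 4 * D * b by rewrite mulrA ler_pM2r//; lra.
  have l2 : D * b <= 2 * (h * b) by rewrite mulrA ler_pM2r//; lra.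
  have hb0 : 0 < 2 * (h * b) by rewrite mulr_gt0// mulr_gt0.
  by split; rewrite -mulrA -invfM ler_pM2l// lef_pV2 ?posrE// mulr_gt0// mulr_gt0.
split.
- apply/eqaddoP => e e0.
  have Dh : D / (c b / b) @[b --> 0^'+] --> (1 : R).
    rewrite -(divff (lt0r_neq0 D0)); apply: cvgM; first exact: cvg_cst.
    by apply: cvgV => //; rewrite gt_eqF.
  have De : \forall b \near 0^'+, `|D / (c b / b) - 1| <= e.
    by move/cvgrPdist_le : Dh => /(_ e e0); under eq_near do rewrite distrC.
  near=> b.
  have b0 : 0 < b by near: b; exact: nbhs_right_gt.
  have h2 : D / 2 < c b / b by near: b.
  have h0 : 0 < c b / b by rewrite (lt_trans _ h2)// divr_gt0.
  have -> : ((fun b => ell / (2 * c b)) - (fun b => ell / (2 * b * D))) b =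
      (D / (c b / b) - 1) * (ell / (2 * b * D)).
    rewrite !fctE; move: (cE b b0) h0; set h := c b / b => -> h0.
    by field; rewrite !gt_eqF.
  by rewrite normrM ler_wpM2r//; near: b.
- apply/cvgryPge => A; near=> b.
  have b0 : 0 < b by near: b; exact: nbhs_right_gt.
  (* Below this threshold the lower bound [ell / (4 * D) * b^-1] exceeds [A]; the [+ 1] keeps the
     divisor positive. *)
  have bA : b < ell / (4 * D) / (`|A| + 1).
    near: b; apply: nbhs_right_lt.
    by rewrite !divr_gt0// ?mulr_gt0// ltr_wpDl.
  have [+ _] : ell / (4 * D) * b^-1 <= ell / (2 * c b) /\
    ell / (2 * c b) <= ell / D * b^-1 by near: b.
  apply: le_trans; rewrite ler_pdivlMr//.
  move: bA; rewrite ltr_pdivlMr ?ltr_wpDl// => bA.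
  rewrite (le_trans _ (ltW bA))// mulrC ler_pM2l//.
  by rewrite (le_trans (ler_norm A))// lerDl.
- rewrite eqThetaE qualifE; apply/asboolP.
  exists (ell / (4 * D), ell / D) => /=; first by rewrite !divr_gt0// mulr_gt0.
  near=> b.
  have b0 : 0 < b by near: b; exact: nbhs_right_gt.
  have [h1 h2] : ell / (4 * D) * b^-1 <= ell / (2 * c b) /\
    ell / (2 * c b) <= ell / D * b^-1 by near: b.
  have f0 : 0 <= ell / (2 * c b).
    by rewrite (le_trans _ h1)// mulr_ge0// ltW ?invr_gt0// divr_gt0// mulr_gt0.
  by rewrite (ger0_norm f0) gtr0_norm ?invr_gt0.
Unshelve. all: by end_near. Qed.

(** * Likelihood ratio and normalizing constant *)

Section likelihood_ratio.
Context {R : realType} {d : measure_display} {X : measurableType d}.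
Context {P0 P1 : probability X R} {r : X -> R}.
Context (P1_ac_P0 : P1 `<< P0) (r_density : is_density_version P1 P0 r).

Let mr : measurable_fun [set: X] r. Proof. by case: r_density. Qed.
Let r0 x : 0 <= r x. Proof. by case: r_density. Qed.

(** Change of variables is available for one specific version of the derivative; that version,
    [density P1 P0] and [r] agree [P0]-almost everywhere. *)
Lemma ge0_integral_density (f : X -> \bar R) (E : set X) :
  (forall x, 0 <= f x)%E -> measurable E -> measurable_fun E f ->
  (\int[P0]_(x in E) (f x * (r x)%:E) = \int[P1]_(x in E) f x)%E.
Proof.
move=> f0 mE mf.
rewrite -(Radon_Nikodym_SigmaFinite.change_of_variables P1_ac_P0 f0 mE mf).
apply: ae_eq_integral => //.
- by apply: emeasurable_funM => //; apply/measurable_EFinP; exact: measurable_funTS.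
- apply: emeasurable_funM => //; apply: measurable_funTS.
  exact: measurable_int (Radon_Nikodym_SigmaFinite.f_integrable P1_ac_P0).
apply: ae_eqe_mul2l; apply: (ae_eq_trans (g := density P1 P0)).
  by case: r_density => _ _; apply: filterS => x + _ => /(_ I) <-.
exact/ae_eq_sym/ae_eq_Radon_Nikodym_SigmaFinite.
Qed.

Lemma probability_density (A : set X) : measurable A ->
  (P1 A = \int[P0]_(x in A) (r x)%:E)%E.
Proof.
move=> mA; have := @ge0_integral_density (cst 1%E) A (fun _ => lee01) mA _.
rewrite integral_cst// mul1e => <-//.
by apply: eq_integral => x _; rewrite mul1e.
Qed.

Lemma integrable_density_mul {f : X -> R} :
  P1.-integrable [set: X] (EFin \o f) ->
  P0.-integrable [set: X] (EFin \o (fun x => f x * r x)).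
Proof.
move=> /integrableP[mf foo]; apply/integrableP; split.
  by apply/measurable_EFinP; apply: measurable_funM => //; apply/measurable_EFinP.
rewrite (eq_integral (fun x => `|(f x)%:E| * (r x)%:E)%E); last first.
  by move=> x _; rewrite /= normrM (ger0_norm (r0 x)) EFinM.
rewrite ge0_integral_density//; exact: measurableT_comp.
Qed.

Lemma integral_density_mul {f : X -> R} :
  P1.-integrable [set: X] (EFin \o f) ->
  (\int[P0]_x (f x * r x)%:E = \int[P1]_x (f x)%:E)%E.
Proof.
move=> fi; rewrite -(Radon_Nikodym_change_of_variables P1_ac_P0 measurableT fi).
apply: ae_eq_integral => //.
- exact (measurable_int _ (integrable_density_mul fi)).
- by apply: emeasurable_funM => //; exact: measurable_int fi.
case: r_density => _ _; apply: filterS => x /(_ I) rd _.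
by rewrite EFinM; congr (_ * _)%E; exact: rd.
Qed.

Lemma integrable_density : P0.-integrable [set: X] (EFin \o r).
Proof.
have := integrable_density_mul (finite_measure_integrable_cst P1 1 measurableT).
by apply: eq_integrable => // x _; rewrite /= mul1r.
Qed.

Lemma integral_density : (\int[P0]_x (r x)%:E = 1)%E.
Proof. by rewrite -probability_density// probability_setT. Qed.

(** The [P1]-measure of the zero set of [r] is the [P0]-integral of [r] over it. *)
Lemma density_gt0_ae : \forall x \ae P1, 0 < r x.
Proof.
have mA : measurable [set x | r x = 0].
  rewrite -[X in measurable X]setTI.
  exact: (mr measurableT [set 0] (measurable_set1 _)).
exists [set x | r x = 0]; split => //.
  rewrite probability_density//.
  by rewrite integral0_eq// => x /= ->.
by move=> x /= /negP; rewrite -leNgt => rx; apply/eqP; rewrite eq_le rx r0.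
Qed.

Lemma KL_density : (KL P1 P0 = \int[P1]_x (ln (r x))%:E)%E.
Proof.
rewrite /KL asboolT//; apply: ae_eq_integral => //.
- exact/measurable_lne_density.
- by apply/measurable_EFinP; exact: measurableT_comp.
have [_ _ rd] := r_density.
have rd1 := null_dominates_ae_eq measurableT P1_ac_P0 rd.
(* [r] agrees with the density [P1]-almost everywhere by domination, and is positive there, so [lne]
   and [ln] coincide. *)
move: (density_gt0_ae) rd1.
apply: filterS2 => x rx /(_ I) /= <- _.
by rewrite lne_EFin.
Qed.

(** * The reverse density under mutual absolute continuity *)

Section dominates.
Context (P0_ac_P1 : P0 `<< P1).

Lemma density_gt0_ae_base : \forall x \ae P0, 0 < r x.
Proof.
have [N [mN N0 rN]] := density_gt0_ae.
exists N; split => //.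
by move: P0_ac_P1 => /null_content_dominatesP; apply.
Qed.

(** Both functions have the same [P1]-integral [P0 A] over every measurable [A]: for the inverse,
    change to [P0] and cancel [r], which is positive [P0]-almost everywhere. *)
Lemma density_inv : ae_eq P1 [set: X] (fun x => ((r x)^-1)%:E) (density P0 P1).
Proof.
have mrV : measurable_fun [set: X] (fun x => ((r x)^-1)%:E).
  under eq_fun do rewrite -powR_inv1//.
  by apply/measurable_EFinP; exact: measurableT_comp (measurable_powR _) mr.
have rV A : measurable A -> (\int[P1]_(x in A) ((r x)^-1)%:E = P0 A)%E.
  move=> mA; rewrite -(ge0_integral_density)//; last 2 first.
  - by move=> x; rewrite lee_fin invr_ge0.
  - exact: measurable_funTS.
  rewrite -[RHS]mul1e -integral_cst//; apply: ae_eq_integral => //.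
    apply: emeasurable_funM; first exact: measurable_funTS.
    by apply/measurable_EFinP; exact: measurable_funTS.
  move: density_gt0_ae_base; apply: filterS => x rx _ /=.
  by rewrite -EFinM mulVf// gt_eqF.
apply: integral_ae_eq => //.
- apply/integrableP; split => //.
  under eq_integral do rewrite gee0_abs ?lee_fin ?invr_ge0//.
  by rewrite rV// (le_lt_trans (probability_le1 _ _))// ltry.
- exact: measurable_int (Radon_Nikodym_integrable _).
- move=> A _ mA; rewrite rV//.
  exact (@Radon_Nikodym_integral _ _ _ (charge_of_finite_measure P0) _ _
    P0_ac_P1 mA).
Qed.

Lemma KL_reverse_density : (KL P0 P1 = \int[P0]_x (- ln (r x))%:E)%E.
Proof.
rewrite /KL asboolT//; apply: ae_eq_integral => //.
- exact/measurable_lne_density.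
- by apply/measurable_EFinP; apply: measurableT_comp => //; exact: measurableT_comp.
have rd1 := null_dominates_ae_eq measurableT P0_ac_P1 density_inv.
move: density_gt0_ae_base rd1; apply: filterS2 => x rx /(_ I) /= <- _.
by rewrite lneV// lne_EFin.
Qed.

End dominates.

(** * Normalizing constant, growth rate and log-variance *)

Lemma Z_integral (b : R) : (Z_ P0 r b = \int[P0]_x (r x `^ b)%:E)%E.
Proof. by rewrite /Z_ unlock. Qed.

Lemma measurable_density_powR (b : R) :
  measurable_fun [set: X] (fun x => r x `^ b).
Proof. exact: measurableT_comp (measurable_powR _) mr. Qed.

Lemma Z_le1 (b : R) : 0 < b <= 1 -> (Z_ P0 r b <= 1)%E.
Proof.
move=> b01; have ri := integrable_density.
have /andP[b0 b1] := b01.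
apply: (@le_trans _ _ (\int[P0]_x (b * r x + 0 * r x + (1 - b))%:E)%E).
  rewrite Z_integral; apply: ge0_le_integral => //.
  - by move=> x _; rewrite lee_fin powR_ge0.
  - exact/measurable_EFinP/measurable_density_powR.
  - exact: measurable_int (integrable_affine2 _ _ _ _ _ _ ri ri).
  - move=> x _; rewrite lee_fin (le_trans (powR_le_affine (r x) b _ _))//.
    by rewrite le_eqVlt; apply/orP; left; apply/eqP; ring.
rewrite integral_affine2// (integral_density) mul0e adde0 mule1 -EFinD lee_fin.
by rewrite addrC subrK.
Qed.

Lemma Z_ge0 (b : R) : (0 <= Z_ P0 r b)%E.
Proof.
by rewrite Z_integral; apply: integral_ge0 => x _; rewrite lee_fin powR_ge0.
Qed.

(** Otherwise [r] would vanish [P0]-almost everywhere, although it integrates to 1. *)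
Lemma Z_gt0 (b : R) : 0 < b -> (0 < Z_ P0 r b)%E.
Proof.
move=> b0; rewrite lt_neqAle Z_ge0 andbT; apply/eqP => Z0.
have rb0 : ae_eq P0 [set: X] (fun x => (r x `^ b)%:E) (cst 0%E).
  apply/ae_eq_integral_abs => //.
    exact/measurable_EFinP/measurable_density_powR.
  rewrite Z0 Z_integral; apply: eq_integral => x _.
  by rewrite gee0_abs// lee_fin powR_ge0.
have : (\int[P0]_x (r x)%:E = \int[P0]_x (cst 0 x))%E.
  apply: ae_eq_integral => //; first exact/measurable_EFinP.
  by apply: filterS rb0 => x /(_ I) /= [/powR_eq0_eq0 ->].
rewrite (integral_density) integral0 => /eqP.
by rewrite onee_eq0.
Qed.

Lemma power_design_ge0 (b : R) (x : X) : 0 <= power_design P0 r b x.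
Proof. by rewrite divr_ge0 ?powR_ge0 ?fine_ge0 ?Z_ge0. Qed.

Lemma measurable_power_design (b : R) :
  measurable_fun [set: X] (power_design P0 r b).
Proof.
apply: measurable_funM; last exact: measurable_cst.
exact: measurable_density_powR.
Qed.

Lemma ln_power_design_ae (b : R) : 0 < b -> (Z_ P0 r b < +oo)%E ->
  \forall x \ae P1, ln (power_design P0 r b x) =
    b * ln (r x) - ln (fine (Z_ P0 r b)).
Proof.
move=> b0 Zoo; have Z0 : 0 < fine (Z_ P0 r b) by rewrite fine_gt0// Z_gt0.
apply: filterS (density_gt0_ae) => x rx.
by rewrite ln_div ?posrE ?powR_gt0// ln_powR.
Qed.

(** Since [r] has [P0]-integral 1, adding [1 - r] costs nothing and makes the integrand pointwise
    nonnegative. *)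
Lemma integral_ln_density : P1.-integrable [set: X] (EFin \o (fun x => ln (r x))) ->
  (\int[P1]_x (ln (r x))%:E =
   \int[P0]_x (r x * ln (r x) - r x + 1)%:E)%E.
Proof.
move=> Li; rewrite -(integral_density_mul Li).
have Lri := integrable_density_mul Li.
have ri := integrable_density.
transitivity (\int[P0]_x (1 * (ln (r x) * r x) + -1 * r x + 1)%:E)%E.
  rewrite (integral_affine2 _ (fun x => ln (r x) * r x))//.
  by rewrite (integral_density) mul1e mule1 -addeA -EFinD addNr adde0.
by apply: eq_integral => x _; congr EFin; ring.
Qed.

Lemma integral_ln_density_eq0 : P1.-integrable [set: X] (EFin \o (fun x => ln (r x))) ->
  (\int[P1]_x (ln (r x))%:E = 0)%E -> \forall x \ae P0, r x = 1.
Proof.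
move=> Li; rewrite integral_ln_density// => phi0.
have phi_ge0 x := xlnx_ge (r x) (r0 x).
have : ae_eq P0 [set: X] (fun x => (r x * ln (r x) - r x + 1)%:E) (cst 0%E).
  apply/ae_eq_integral_abs => //.
    apply/measurable_EFinP/measurable_funD => //; apply: measurable_funB => //.
    by apply: measurable_funM => //; exact: measurableT_comp.
  by rewrite -phi0; apply: eq_integral => x _; rewrite gee0_abs// lee_fin.
by apply: filterS => x /(_ I) [/xlnx_eq]; apply.
Qed.

(** From [ln r <= r], the negative part of [- ln r] is dominated by [r]; finiteness of the
    divergence bounds the integral from above. *)
Lemma log_density_integrable_base :
  P0 `<< P1 -> (KL P0 P1 < +oo)%E ->
  P0.-integrable [set: X] (EFin \o (fun x => ln (r x))).
Proof.
move=> P0_ac_P1 KLoo.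
have mNL : measurable_fun [set: X] (fun x => (- ln (r x))%:E).
  by apply/measurable_EFinP; apply: measurableT_comp => //; exact: measurableT_comp.
have /integrableN : P0.-integrable [set: X] (fun x => (- ln (r x))%:E).
  apply: (integrable_bounded_below _ _ (EFin \o r)) => //.
  - exact: integrable_density.
  - move=> x; rewrite -EFinN opprK lee_fin.
    have := r0 x; rewrite le_eqVlt => /predU1P[<-|rx]; first by rewrite ln0.
    exact/ltW/ln_sublinear.
  - by move: KLoo; rewrite (KL_reverse_density).
by apply: eq_integrable => // x _; rewrite /= opprK.
Qed.

Lemma powR_density_integrable (b : R) : (Z_ P0 r b < +oo)%E ->
  P0.-integrable [set: X] (EFin \o (fun x => r x `^ b)).
Proof.
rewrite Z_integral => Zoo; apply: ge0_integrable => //.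
  exact/measurable_EFinP/(measurable_density_powR).
by move=> x; rewrite lee_fin powR_ge0.
Qed.

Lemma Z_quotient_integral (b : R) : 0 < b <= 1 ->
  (((fine (Z_ P0 r b) - 1) / b)%:E = \int[P0]_x ((r x `^ b - 1) / b)%:E)%E.
Proof.
move=> b01; have Zoo : (Z_ P0 r b < +oo)%E.
  by rewrite (le_lt_trans (Z_le1 _ b01))// ltry.
have ri := powR_density_integrable b Zoo.
rewrite (eq_integral (fun x => (b^-1 * r x `^ b + 0 * r x `^ b + - b^-1)%:E)%E).
  rewrite integral_affine2// -Z_integral -(fineK (x := Z_ P0 r b)); last first.
    by rewrite ge0_fin_numE// Z_ge0.
  by rewrite -!EFinM -!EFinD; congr EFin => /=; ring.
by move=> x _; congr EFin; ring.
Qed.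

Lemma Z_quotient_cvg :
  P0 `<< P1 -> P0.-integrable [set: X] (EFin \o (fun x => ln (r x))) ->
  (fine (Z_ P0 r b) - 1) / b @[b --> 0^'+] -->
    fine (\int[P0]_x (ln (r x))%:E)%E.
Proof.
move=> P0_ac_P1 Li; apply/cvg_at_rightP => u [u0 ucvg].
(* The dominating function [|ln r| + r] is only valid for exponents at most 1. *)
pose w n := Num.min (u n) 1.
have w0 n : 0 < w n by rewrite lt_min u0 ltr01.
have w01 n : 0 < w n <= 1 by rewrite w0 ge_min lexx orbT.
have uw : \forall n \near \oo, w n = u n.
  have u1 : \forall n \near \oo, u n < 1.
    by move/cvgr_lt : ucvg; apply; exact: ltr01.
  by near=> n; rewrite /w min_l// ltW//; near: n.
have wcvg : w n @[n --> \oo] --> 0.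
  by apply: cvg_trans ucvg; apply: near_eq_cvg; apply: filterS uw => n ->.
have rgt0 := density_gt0_ae_base P0_ac_P1.
pose f_ n x := ((r x `^ w n - 1) / w n)%:E.
pose g x := (`|(ln (r x))%:E| + (r x)%:E)%E.
have mf_ n : measurable_fun [set: X] (f_ n).
  apply/measurable_EFinP; apply: measurable_funM => //.
  by apply: measurable_funB => //; exact: measurable_density_powR _.
have mL : measurable_fun [set: X] (EFin \o (fun x => ln (r x))).
  by apply/measurable_EFinP; exact: measurableT_comp.
have f_L : {ae P0, forall x, [set: X] x ->
    f_ ^~ x @ \oo --> (EFin \o (fun x => ln (r x))) x}.
  apply: filterS rgt0 => x rx _; apply: cvg_EFin; first exact: nearW.
  exact: powR_quotient_cvg.
have gi : P0.-integrable [set: X] g.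
  apply: integrableD => //; first exact: integrable_abse.
  exact: integrable_density.
(* The quotient lies between [ln r] and [r - 1], the upper bound using [w n <= 1]. *)
have f_g : {ae P0, forall x n, [set: X] x -> (`|f_ n x| <= g x)%E}.
  apply: filterS rgt0 => x rx n _; rewrite lee_fin ler_norml.
  have := powR_quotient_ge (r x) (w n) rx (w0 n).
  have : (r x `^ w n - 1) / w n <= r x - 1.
    rewrite ler_pdivrMr//.
    by have := powR_le_affine (r x) (w n) (ltW rx) (w01 n); lra.
  have := ler_norm (ln (r x)); have := ler_norm (- ln (r x)).
  rewrite normrN; move: rx; lra.
have [_ _ dct] := dominated_convergence measurableT mf_ mL f_L gi f_g.
suff zw : (fine (Z_ P0 r (w n)) - 1) / w n @[n --> \oo] -->
    fine (\int[P0]_x (ln (r x))%:E)%E.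
  apply: cvg_trans zw; apply: near_eq_cvg.
  by apply: filterS uw => n ->.
apply: (@fine_cvg _ _ _ _ (fun n => ((fine (Z_ P0 r (w n)) - 1) / w n)%:E)).
rewrite fineK; last exact: integrable_fin_num.
under eq_fun do rewrite Z_quotient_integral//.
exact: dct.
Unshelve. all: by end_near. Qed.

Lemma ln_Z_quotient_cvg :
  P0 `<< P1 -> P0.-integrable [set: X] (EFin \o (fun x => ln (r x))) ->
  ln (fine (Z_ P0 r b)) / b @[b --> 0^'+] -->
    fine (\int[P0]_x (ln (r x))%:E)%E.
Proof.
move=> P0_ac_P1 Li; set M := fine _.
pose q b := (fine (Z_ P0 r b) - 1) / b.
have qM : q b @[b --> 0^'+] --> M := Z_quotient_cvg P0_ac_P1 Li.
(* The limit of the quotient gives this at once, as [Z_b = 1 + b * q b]. *)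
have Z1 : fine (Z_ P0 r b) @[b --> 0^'+] --> (1 : R).
  have bq1 : b * q b + 1 @[b --> 0^'+] --> (1 : R).
    rewrite [X in _ --> X](_ : 1 = 0 * M + 1); last by rewrite mul0r add0r.
    apply: cvgD; last exact: cvg_cst.
    by apply: cvgM qM; apply: cvg_at_right_filter; exact: cvg_id.
  apply: cvg_trans bq1; apply: near_eq_cvg; near=> b.
  by rewrite /q mulrC divfK ?subrK// gt_eqF//; near: b; exact: nbhs_right_gt.
apply: (@squeeze_cvgr _ _ _ _ (fun b => q b / fine (Z_ P0 r b)) q) => //.
- near=> b.
  have b0 : 0 < b by near: b; exact: nbhs_right_gt.
  have b1 : b <= 1 by near: b; exact: nbhs_right_le.
  have b01 : 0 < b <= 1 by rewrite b0.
  have Z0 : 0 < fine (Z_ P0 r b).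
    rewrite fine_gt0// (Z_gt0)//=.
    by rewrite (le_lt_trans (Z_le1 _ b01))// ltry.
  have lnx (z : R) : 0 < z -> ln z <= z - 1.
    by move=> z0; have := @le_ln1Dx R (z - 1); rewrite [1 + _]addrC subrK; apply; lra.
  apply/andP; split; last by rewrite ler_pM2r ?invr_gt0// lnx.
  rewrite /q mulrAC ler_pM2r ?invr_gt0//.
  rewrite mulrBl divff ?gt_eqF// mul1r.
  (* The lower squeeze bound is [ln z <= z - 1] at [z = 1 / Z_b]. *)
  by have := lnx _ (_ : 0 < (fine (Z_ P0 r b))^-1); rewrite invr_gt0 lnV//; lra.
- rewrite -[X in _ --> X]mulr1 -invr1; apply: cvgM => //.
  by apply: cvgV => //; rewrite oner_eq0.
Unshelve. all: by end_near. Qed.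

(** Ensures that [fine] loses nothing in [growth_rate] and [log_variance]: both are genuine finite
    moments, ready for the maximal inequality. *)
Lemma growth_rate_log_varianceE (b : R) :
  ('V_P1[(fun x => ln (r x))%R] < +oo)%E -> 0 < b -> (Z_ P0 r b < +oo)%E ->
  let L b x := ln (power_design P0 r b x) in
  let c := growth_rate P0 P1 r b in
  let v := log_variance P0 P1 r b in
  [/\ c = b * fine (\int[P1]_x (ln (r x))%:E)%E - ln (fine (Z_ P0 r b)),
      v%:E = ((b ^+ 2)%:E * 'V_P1[(fun x => ln (r x))%R])%E &
      [/\ P1.-integrable [set: X] (EFin \o L b), (\int[P1]_x (L b x)%:E = c%:E)%E,
          P1.-integrable [set: X] (EFin \o (fun x => (L b x - c) ^+ 2)) &
          (\int[P1]_x ((L b x - c) ^+ 2)%:E = v%:E)%E]].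
Proof.
move=> Voo b0 Zoo L c v.
have mL : measurable_fun [set: X] (L b).
  exact: measurableT_comp (measurable_power_design b).
have mlnr : measurable_fun [set: X] (fun x => ln (r x)) by exact: measurableT_comp.
have lnL := ln_power_design_ae b b0 Zoo.
have [Li LE L2i L2E] := integral_ae_affine P1 _ _ _ _ mL mlnr Voo lnL.
have cE : c = b * fine (\int[P1]_x (ln (r x))%:E)%E - ln (fine (Z_ P0 r b)).
  by rewrite /c /growth_rate unlock LE.
have Vfin : 'V_P1[(fun x => ln (r x))%R] \is a fin_num.
  by rewrite ge0_fin_numE// variance_ge0.
have vE : v%:E = ((b ^+ 2)%:E * 'V_P1[(fun x => ln (r x))%R])%E.
  by rewrite /v /log_variance varianceE_integral LE L2E fineK// fin_numM.
by rewrite -cE in LE L2i L2E; rewrite -vE in L2E; split.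
Qed.

(** A zero mean forces [r = 1] [P0]-almost everywhere, hence [P1 = P0], which the set [A]
    excludes. *)
Lemma log_density_mean_gt0 :
  P1.-integrable [set: X] (EFin \o (fun x => ln (r x))) ->
  (exists A : set X, measurable A /\ P0 A <> P1 A) ->
  0 < fine (\int[P1]_x (ln (r x))%:E)%E.
Proof.
move=> Li [A [mA PA]].
rewrite lt_neqAle fine_ge0 ?andbT; last first.
  rewrite (integral_ln_density)//.
  by apply: integral_ge0 => x _; rewrite lee_fin xlnx_ge.
apply/eqP => /esym K0; apply: PA.
have r1 : \forall x \ae P0, r x = 1.
  apply: (integral_ln_density_eq0) => //.
  by rewrite -[LHS]fineK ?K0// integrable_fin_num.
rewrite (probability_density)// -[LHS]mul1e -integral_cst//.
apply: ae_eq_integral => //.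
  by apply/measurable_EFinP; exact: measurable_funTS.
by apply: filterS r1 => x -> _.
Qed.

Lemma log_density_mean_eq0 :
  P1.-integrable [set: X] (EFin \o (fun x => ln (r x))) ->
  fine (\int[P1]_x (ln (r x))%:E)%E = 0 -> 'V_P1[(fun x => ln (r x))%R] = 0%E.
Proof.
move=> Li K0.
have r1 : ae_eq P0 [set: X] r (cst 1).
  apply: filterS (integral_ln_density_eq0 Li _) => //.
  by rewrite -[LHS]fineK ?K0// integrable_fin_num.
have {}r1 := null_dominates_ae_eq measurableT P1_ac_P0 r1.
rewrite varianceE_integral K0 -[RHS](integral0 P1 [set: X]).
apply: ae_eq_integral => //.
  apply/measurable_EFinP/measurable_funX/measurable_funB => //.
  exact: measurableT_comp.
by apply: filterS r1 => x /(_ I) /= -> _; rewrite ln1 subrr expr0n.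
Qed.

End likelihood_ratio.

(** * Power bound, its order in [b], and the growth of the horizon *)

Theorem corollary5p11 (R : realType) (d : measure_display) (X : measurableType d)
    (P0 P1 : probability X R) (P1_ac_P0 : P1 `<< P0)
    (KL10_fin : (KL P1 P0 < +oo)%E)
    (r : X -> R) (r_density : is_density_version P1 P0 r)
    (var_fin : ('V_P1[(fun x => ln (r x))%R] < +oo)%E)
    (PP : probability (path_space X) R) (PP_prod : is_infinite_product P1 PP)
    (alpha : R) (alpha_gt0 : 0 < alpha) (alpha_lt1 : alpha < 1) :
  let ell := ln (alpha^-1) in
  let c := growth_rate P0 P1 r in
  let v := log_variance P0 P1 r in
  (forall b : R, 0 < b -> (Z_ P0 r b < +oo)%E ->
    (v b)%:E = ((b ^+ 2)%:E * 'V_P1[(fun x => ln (r x))%R])%E /\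
    (2 * v b < c b * ell ->
     forall t : nat, t%:R <= ell / (2 * c b) ->
       (1 - type2_error PP (power_design P0 r b) alpha t
          <= (2 * v b / (c b * ell))%:E)%E)) /\
  (fun b : R => 2 * v b / (c b * ell)) =O_ (0^'+) (fun b : R => b) /\
  ((KL P0 P1 < +oo)%E ->
   (exists A : set X, measurable A /\ P0 A <> P1 A) ->
   [/\ (fun b : R => ell / (2 * c b)) ~_ (0^'+)
         (fun b : R => ell / (2 * b * fine (KL P0 P1 + KL P1 P0)%E)),
       ell / (2 * c b) @[b --> 0^'+] --> +oo &
       (fun b : R => ell / (2 * c b)) =Theta_ (0^'+) (fun b : R => b^-1)]).
Proof.
move=> ell c v.
have ell0 : 0 < ell by rewrite ln_gt0// invf_gt1.
have [mr r0 _] := r_density.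
have stats := growth_rate_log_varianceE P1_ac_P0 r_density.
have [Li _] : P1.-integrable [set: X] (EFin \o (fun x => ln (r x))) /\
    P1.-integrable [set: X] (EFin \o (fun x => ln (r x) ^+ 2)).
  by apply: finite_variance_integrable => //; exact: measurableT_comp.
set K := fine (\int[P1]_x (ln (r x))%:E)%E in stats.
have KE : (\int[P1]_x (ln (r x))%:E = K%:E)%E.
  by rewrite fineK// integrable_fin_num.
(* The limit statements concern small [b] only, and on this range [Z_b] is finite because it is at
   most 1. *)
have near0 : \forall b \near (0 : R)^'+, 0 < b <= 1.
  near=> b; apply/andP; split; near: b.
    exact: nbhs_right_gt.
  exact: nbhs_right_le.
have Zoo b : 0 < b <= 1 -> (Z_ P0 r b < +oo)%E.
  by move=> b01; rewrite (le_lt_trans (Z_le1 P1_ac_P0 r_density _ b01))// ltry.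
have Z1 b : 0 < b <= 1 -> fine (Z_ P0 r b) <= 1.
  move=> b01; rewrite -lee_fin fineK; first exact: Z_le1 P1_ac_P0 r_density _ b01.
  by rewrite ge0_fin_numE ?Zoo// Z_ge0.
split; [|split].
- move=> b b0 Zb; have [cE vE [Lbi LbE Lb2i Lb2E]] := stats b var_fin b0 Zb.
  split => // vc t; apply: (power_le_of_short_horizon P1) => //.
  + exact: measurable_power_design r_density b.
  + exact: power_design_ge0.
  + have v0 : 0 <= v b.
      rewrite -lee_fin -Lb2E; apply: integral_ge0 => x _.
      by rewrite lee_fin sqr_ge0.
    (* Positivity of [c b] is extracted from [0 <= 2 * v b < c b * ell]. *)
    by rewrite -(pmulr_lgt0 _ ell0) (le_lt_trans _ vc)// mulr_ge0.
- have := fine_ge0 (variance_ge0 P1 (fun x => ln (r x))).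
  set V := fine _ => V0.
  have vE b : 0 < b <= 1 -> v b = b ^+ 2 * V.
    move=> b01; have /andP[b0 _] := b01.
    have [_ vE _] := stats b var_fin b0 (Zoo b b01).
    by rewrite -[v b]/(fine (v b)%:E) vE fineM// ge0_fin_numE// variance_ge0.
  have : 0 <= K.
    rewrite fine_ge0// (integral_ln_density P1_ac_P0 r_density)//.
    by apply: integral_ge0 => x _; rewrite lee_fin xlnx_ge.
  rewrite le_eqVlt => /predU1P[K0|K0].
    apply/eqO_exP; exists 1 => //; near=> b.
    have b01 : 0 < b <= 1 by near: b.
    rewrite vE// /V (log_density_mean_eq0 P1_ac_P0 r_density)//=.
    by rewrite !mulr0 mul0r normr0 mul1r.
  (* The first term comes from [v b = b ^+ 2 * V] and [c b >= b * K]; the [+ 1] keeps the constant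
     positive when [V = 0]. *)
  apply/eqO_exP; exists (2 * V / (K * ell) + 1).
    by rewrite ltr_wpDl// divr_ge0// mulr_ge0// ltW.
  near=> b.
  have b01 : 0 < b <= 1 by near: b.
  have /andP[b0 b1] := b01.
  have [cE _ _] := stats b var_fin b0 (Zoo b b01).
  have cK : b * K <= c b.
    by rewrite /c cE lerDl oppr_ge0 ln_le0// Z1.
  have c0 : 0 < c b by rewrite (lt_le_trans _ cK)// mulr_gt0.
  rewrite vE// ger0_norm; last first.
    by rewrite divr_ge0// ?mulr_ge0 ?sqr_ge0// ltW.
  rewrite gtr0_norm// (@le_trans _ _ (2 * V / (K * ell) * b))//; last first.
    by rewrite ler_pM2r// lerDl.
  have -> : 2 * V / (K * ell) * b = 2 * (b ^+ 2 * V) / (b * K * ell).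
    by field; rewrite !gt_eqF.
  rewrite ler_wpM2l// ?mulr_ge0 ?sqr_ge0//.
  by rewrite lef_pV2 ?posrE ?mulr_gt0// ler_pM2r.
- move=> KLoo PA.
  have P0_ac_P1 : P0 `<< P1.
    (* [KL] is [+oo] by definition without absolute continuity. *)
    by move: KLoo; rewrite /KL; case: asboolP => // _; rewrite ltxx.
  have L0i := log_density_integrable_base P1_ac_P0 r_density P0_ac_P1 KLoo.
  have := ln_Z_quotient_cvg P1_ac_P0 r_density P0_ac_P1 L0i.
  set M := fine _ => ZM.
  have ME : (\int[P0]_x (ln (r x))%:E = M%:E)%E.
    by rewrite fineK// integrable_fin_num.
  have -> : fine (KL P0 P1 + KL P1 P0)%E = K - M.
    rewrite (KL_reverse_density P1_ac_P0 r_density)//.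
    rewrite (KL_density P1_ac_P0 r_density)// KE.
    under eq_integral do rewrite EFinN.
    by rewrite integralN ?integrable_add_def// ME/= addrC.
  (* Obtained as a limit of [ln Z_b / b] with [Z_b <= 1]; together with [K > 0] it makes the sum of
     divergences [K - M] positive. *)
  have M0 : M <= 0.
    apply: (ler_cvg_to ZM (cvg_cst 0)).
    near=> b.
    have b01 : 0 < b <= 1 by near: b.
    have /andP[b0 b1] := b01.
    by rewrite ler_pdivrMr// mul0r ln_le0// Z1.
  have K0 : 0 < K by exact: (log_density_mean_gt0 P1_ac_P0 r_density).
  apply: inverse_rate_asymptotics => //; first by lra.
  have KM : K - ln (fine (Z_ P0 r b)) / b @[b --> 0^'+] --> K - M.
    by apply: cvgB => //; exact: cvg_cst.
  apply: cvg_trans KM; apply: near_eq_cvg; near=> b.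
  have b01 : 0 < b <= 1 by near: b.
  have /andP[b0 b1] := b01.
  have [cE _ _] := stats b var_fin b0 (Zoo b b01).
  by rewrite /c cE mulrBl mulrAC divff ?mul1r// gt_eqF.
Unshelve. all: by end_near. Qed.
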